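(* Let $E$ be a closed set in $\mathbb R^n$, let $\Omega=\mathbb R^n\setminus E$, and let $D:\mathbb R^n\to[0,\infty)$ be a continuous nonnegative function which vanishes on $E$, is of class $C^1$ on $\Omega$, and is such that $|\nabla D|$ is positive and constant on every connected component of $\Omega$ (the constant may depend on the component). Then $E$ is convex. If, in addition, $|\nabla D|=1$ on $\Omega$, then $D(x)=\mathrm{dist}(x,E)$ for all $x\in\mathbb R^n$.
   Context: $|\cdot|$ is the Euclidean norm and $\mathrm{dist}$ the Euclidean distance. *)

(* Defs.v *)
From mathcomp Require Import all_boot all_order all_algebra.
From mathcomp Require Import all_classical all_reals all_analysis.

Set Implicit Arguments.
Unset Strict Implicit.
Unset Printing Implicit Defensive.

Import Order.TTheory GRing.Theory Num.Theory.
Import numFieldNormedType.Exports.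

Local Open Scope classical_set_scope.
Local Open Scope ring_scope.

(* The library norm [`|x|] on ['rV[R]_n] is the sup norm; it induces the same
   topology and the same notion of differentiability as [enorm]. *)
Definition enorm (R : realType) (n : nat) (x : 'rV[R]_n) : R :=
  Num.sqrt (\sum_(i < n) x ord0 i ^+ 2).

(* As [inf set0 = 0], this is meaningful only for nonempty [E]. *)
Definition edist_to (R : realType) (n : nat) (x : 'rV[R]_n)
    (E : set 'rV[R]_n) : R :=
  inf [set enorm (x - y) | y in E].

Definition grad (R : realType) (n : nat) (f : 'rV[R]_n -> R) (x : 'rV[R]_n) :
    'rV[R]_n :=
  \row_(i < n) 'D_(delta_mx ord0 i) f x.

Definition C1_on (R : realType) (n : nat) (U : set 'rV[R]_n)
    (f : 'rV[R]_n -> R) : Prop :=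
  (forall x, U x -> differentiable f x) /\ {within U, continuous (grad f)}.

(* Main.v *)
(** Where the gradient has constant norm [c], maximizing [- D - k * enorm (_ - x)]
    over a closed ball around [x], for [k < c], shows that [D] falls by at least
    [k * r] within distance [r]; letting [k] tend to [c], [D x >= c * dist(x, E)].
    The mean value theorem along the segment to a nearest point gives the converse,
    so [D] is locally a multiple of the distance [d] to [E], and [d] is
    differentiable with unit gradient off [E]. The same maximization applied to [d]
    gives, for every [r] and [k < 1], a point [y] at distance at most [r] from [x]
    with [d y >= d x + k * r]. For large [r] the ball of radius [d y] about [y] is
    nearly a half-space containing [x] and missing [E], which is impossible if [x]
    lies on a segment between two points of [E]. *)
Require Import Defs.
From mathcomp Require Import all_boot all_order all_algebra.
From mathcomp Require Import all_classical all_reals all_analysis.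
From mathcomp Require Import ring lra.

Set Implicit Arguments.
Unset Strict Implicit.
Unset Printing Implicit Defensive.

Import Order.TTheory GRing.Theory Num.Theory.
Import numFieldNormedType.Exports.
Local Open Scope classical_set_scope.
Local Open Scope ring_scope.

(** * The Euclidean norm: algebra, Cauchy-Schwarz, continuity, compact balls *)

Lemma enorm_ge0 (R : realType) (n : nat) (x : 'rV[R]_n) : 0 <= enorm x.
Proof. exact: sqrtr_ge0. Qed.

Lemma enorm_sqr (R : realType) (n : nat) (x : 'rV[R]_n) :
  enorm x ^+ 2 = \sum_(i < n) x ord0 i ^+ 2.
Proof. by rewrite sqr_sqrtr// sumr_ge0// => i _; rewrite sqr_ge0. Qed.

Lemma enormZ (R : realType) (n : nat) (a : R) (x : 'rV[R]_n) :
  enorm (a *: x) = `|a| * enorm x.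
Proof.
rewrite /enorm -sqrtr_sqr -sqrtrM ?sqr_ge0// mulr_sumr; congr Num.sqrt.
by apply: eq_bigr => i _; rewrite mxE exprMn.
Qed.

Lemma enormN (R : realType) (n : nat) (x : 'rV[R]_n) : enorm (- x) = enorm x.
Proof. by rewrite -scaleN1r enormZ normrN1 mul1r. Qed.

Lemma enormB (R : realType) (n : nat) (x y : 'rV[R]_n) :
  enorm (x - y) = enorm (y - x).
Proof. by rewrite -enormN opprB. Qed.

Lemma enorm0 (R : realType) (n : nat) : enorm (0 : 'rV[R]_n) = 0.
Proof. by rewrite -(scale0r 0) enormZ normr0 mul0r. Qed.

Lemma coord_le_enorm (R : realType) (n : nat) (x : 'rV[R]_n) (i : 'I_n) :
  `|x ord0 i| <= enorm x.
Proof.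
rewrite -sqrtr_sqr ler_wsqrtr// (bigD1 i)//= lerDl sumr_ge0// => j _.
by rewrite sqr_ge0.
Qed.

Lemma enorm_eq0 (R : realType) (n : nat) (x : 'rV[R]_n) : enorm x = 0 -> x = 0.
Proof.
move=> x0; apply/rowP => i; rewrite mxE; apply/eqP.
by rewrite -normr_le0 -x0 coord_le_enorm.
Qed.

(** Expanding the nonnegative sum of squares of [b * x - a * y] gives [2ab(ab - s)]. If [ab] is not
    positive, one of the vectors is zero. *)
Lemma cauchy_schwarz (R : realType) (n : nat) (x y : 'rV[R]_n) :
  \sum_(i < n) x ord0 i * y ord0 i <= enorm x * enorm y.
Proof.
set a := enorm x; set b := enorm y; set s := \sum_(i < n) _.
have [a0 b0] : 0 <= a /\ 0 <= b by split; exact: enorm_ge0.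
have : 0 <= \sum_(i < n) (b * x ord0 i - a * y ord0 i) ^+ 2.
  by apply: sumr_ge0 => i _; rewrite sqr_ge0.
have -> : \sum_(i < n) (b * x ord0 i - a * y ord0 i) ^+ 2 =
    2 * (a * b) * (a * b - s).
  transitivity (b ^+ 2 * (\sum_(i < n) x ord0 i ^+ 2)
      + a ^+ 2 * (\sum_(i < n) y ord0 i ^+ 2) - 2 * a * b * s); last first.
    by rewrite -!enorm_sqr -/a -/b; ring.
  rewrite !mulr_sumr -big_split -sumrB/=.
  by apply: eq_bigr => i _; ring.
have [ab0|ab0] := ltP 0 (a * b).
  by move=> h; rewrite -subr_ge0 -(pmulr_rge0 _ (mulr_gt0 (ltr0Sn R 1) ab0)).
move=> _; have /eqP : a * b = 0 by apply/eqP; rewrite eq_le ab0 mulr_ge0.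
rewrite mulf_eq0 => /orP[]/eqP /enorm_eq0 z0.
- by rewrite /s z0 big1 ?mulr_ge0// => i _; rewrite mxE mul0r.
- by rewrite /s z0 big1 ?mulr_ge0// => i _; rewrite mxE mulr0.
Qed.

Lemma ler_enormD (R : realType) (n : nat) (x y : 'rV[R]_n) :
  enorm (x + y) <= enorm x + enorm y.
Proof.
rewrite -ler_sqr ?nnegrE ?addr_ge0 ?enorm_ge0//.
have -> : enorm (x + y) ^+ 2 = enorm x ^+ 2 + enorm y ^+ 2
    + 2 * \sum_(i < n) x ord0 i * y ord0 i.
  rewrite !enorm_sqr mulr_sumr -!big_split/=; apply: eq_bigr => i _.
  by rewrite mxE; ring.
rewrite sqrrD -mulr_natl; have := cauchy_schwarz x y; lra.
Qed.

Lemma ler_enorm_dist (R : realType) (n : nat) (y x z : 'rV[R]_n) :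
  enorm (x - z) <= enorm (x - y) + enorm (y - z).
Proof. by rewrite -(subrKA y x (- z)) ler_enormD. Qed.

Lemma enorm_continuous (R : realType) (n : nat) :
  continuous (@enorm R n).
Proof.
move=> x; apply: (@continuous_comp _ _ _ (fun x : 'rV[R]_n =>
  \sum_(i < n) x ord0 i ^+ 2) Num.sqrt); last exact: sqrt_continuous.
(* Passing from the full index range to an arbitrary list of indices allows induction. *)
suff: forall s, continuous_at x (fun y : 'rV[R]_n => \sum_(i <- s) y ord0 i ^+ 2).
  by exact.
elim=> [|i s IHs].
  rewrite [F in continuous_at _ F](_ : _ = cst 0); first exact: cst_continuous.
  by apply/funext => y; rewrite big_nil.
rewrite [F in continuous_at _ F](_ : _ = (fun y : 'rV[R]_n => y ord0 i ^+ 2)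
    \+ (fun y => \sum_(i <- s) y ord0 i ^+ 2)); last first.
  by apply/funext => y; rewrite big_cons.
apply: continuousD IHs; apply: (@continuous_comp _ _ _
  (fun y : 'rV[R]_n => y ord0 i) (@GRing.exp R ^~ 2)).
  exact: coord_continuous.
exact: exprn_continuous.
Qed.

Lemma enorm_sub_continuous (R : realType) (n : nat) (x : 'rV[R]_n) :
  continuous (fun y : 'rV[R]_n => enorm (y - x)).
Proof.
move=> y; apply: (@continuous_comp _ _ _ (fun y : 'rV[R]_n => y - x) (@enorm R n)).
  by apply: continuousB; [exact: cvg_id|exact: cst_continuous].
exact: enorm_continuous.
Qed.

(** Coordinates are bounded by the norm, so the ball is a closed subset of a compact box. *)
Lemma eball_compact (R : realType) (n : nat) (x : 'rV[R]_n) (r : R) :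
  compact [set y : 'rV[R]_n | enorm (y - x) <= r].
Proof.
have coordP : compact [set y : 'rV[R]_n |
    forall i, `[x ord0 i - r, x ord0 i + r]%classic (y ord0 i)].
  by apply: (@rV_compact R n
    (fun i => `[x ord0 i - r, x ord0 i + r]%classic)) => i; exact: segment_compact.
apply: (subclosed_compact _ coordP).
  rewrite [X in closed X](_ : _ = (fun y : 'rV[R]_n => enorm (y - x)) @^-1` [set t | t <= r])//.
  by apply: preimage_closed => [? _|]; [exact: enorm_sub_continuous|exact: closed_le].
move=> y /= yr i; rewrite /= in_itv/= -ler_distl.
by apply: le_trans yr; have := coord_le_enorm (y - x) i; rewrite !mxE.
Qed.

Lemma nbhs_eball (R : realType) (n : nat) (x y : 'rV[R]_n) (r : R) :
  enorm (y - x) < r -> \forall z \near y, enorm (z - x) < r.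
Proof. move=> yr; exact: (@cvgr_lt R _ (nbhs y) _ (fun z => enorm (z - x)) _
  (@enorm_sub_continuous R n x y) r yr). Qed.

(** * Ascent within a ball, gradients and derivatives along lines *)

(* Maximize [f - k * enorm (_ - x)] over the closed ball: the maximizer cannot be
   an interior point. *)
Lemma ascent (R : realType) (n : nat) (f : 'rV[R]_n -> R) (x : 'rV[R]_n)
    (r k : R) :
  0 <= r -> 0 <= k -> continuous f ->
  (forall y, enorm (y - x) < r -> f x <= f y ->
     exists2 z, enorm (z - x) <= r & f y + k * enorm (z - y) < f z) ->
  exists2 y, enorm (y - x) <= r & f x + k * r <= f y.
Proof.
move=> r0 k0 fc step.
pose h y : R := f y - k * enorm (y - x).
have hc : continuous h.
  move=> y; exact: (cvgB (fc y) (@cvgMl_tmp _ _ _ _ _ k _ (@enorm_sub_continuous R n x y))).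
have [|y /[!inE]/= yr ymax] := EVT_max_rV _ (@eball_compact R n x r)
  (continuous_subspaceT hc).
  by exists x => /=; rewrite subrr enorm0.
have := ymax x; rewrite inE/= subrr enorm0 => /(_ r0).
rewrite /h subrr enorm0 mulr0 subr0 => fxy.
(* On the sphere, [h x <= h y] is already the claim. *)
exists y => //; have [yltr|ryx] := ltP (enorm (y - x)) r; last first.
  by have <- : enorm (y - x) = r by [apply/eqP; rewrite eq_le yr]; lra.
have fle : f x <= f y by have := mulr_ge0 k0 (enorm_ge0 (y - x)); lra.
(* By the triangle inequality, a gain at [z] above [k * enorm (z - y)] makes [h z > h y], against
   maximality. *)
have [z zr fyz] := step y yltr fle.
have := ymax z; rewrite inE => /(_ zr); rewrite /h.
have := ler_wpM2l k0 (ler_enorm_dist y z x); lra.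
Qed.

Lemma derive_grad (R : realType) (n : nat) (f : 'rV[R]_n -> R)
    (x v : 'rV[R]_n) :
  differentiable f x -> 'D_v f x = \sum_(i < n) grad f x ord0 i * v ord0 i.
Proof.
move=> df; rewrite deriveE// {1}(row_sum_delta v) raddf_sum/=.
by apply: eq_bigr => i _; rewrite linearZ/= mxE deriveE// mulrC.
Qed.

(** The derivative along the gradient [g] is [enorm g ^+ 2 > k * enorm g], so a short step [h *: g]
    gains more than [k] times its length. *)
Lemma grad_ascent (R : realType) (n : nat) (f : 'rV[R]_n -> R) (x : 'rV[R]_n)
    (k : R) (U : set 'rV[R]_n) :
  differentiable f x -> 0 < enorm (grad f x) -> k < enorm (grad f x) ->
  nbhs x U -> exists2 y, U y & f x + k * enorm (y - x) < f y.
Proof.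
move=> df g0 kg xU; set g := grad f x in g0 kg *.
have cq : h^-1 *: (f (h *: g + x) - f x) @[h --> 0^'] --> enorm g ^+ 2.
  rewrite (_ : enorm g ^+ 2 = 'D_g f x); first exact: diff_derivable.
  by rewrite derive_grad// enorm_sqr; apply: eq_bigr => i _; rewrite expr2.
have cU : h *: g + x @[h --> (0 : R)] --> 0 *: g + x.
  by apply: cvgD; [apply: cvgZr_tmp; exact: cvg_id|exact: cvg_cst].
rewrite scale0r add0r in cU.
near (0 : R)^'+ => h.
have h0 : 0 < h by near: h; exact: nbhs_right_gt.
exists (h *: g + x); first by near: h; apply: cvg_within; exact: cU.
rewrite addrK enormZ gtr0_norm// -ltrBrDl mulrCA -(ltr_pdivlMl _ _ h0).
near: h.
apply: (cvgr_gt _ (cvg_dnbhs_at_right cq)).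
by rewrite expr2 ltr_pM2r.
Unshelve. all: by end_near. Qed.


Lemma is_derive_line (R : realType) (n : nat) (f : 'rV[R]_n -> R)
    (p v : 'rV[R]_n) (t : R) :
  differentiable f (p + t *: v) ->
  is_derive t 1 (fun s => f (p + s *: v)) ('D_v f (p + t *: v)).
Proof.
move=> df; have dv : derivable f (p + t *: v) v by exact: diff_derivable.
have E : (fun h : R => h^-1 *: (((fun s => f (p + s *: v)) \o shift t) (h *: 1)
    - f (p + t *: v))) =
  (fun h : R => h^-1 *: ((f \o shift (p + t *: v)) (h *: v) - f (p + t *: v))).
  apply/funext => h /=; congr (_ *: (f _ - _)).
  by rewrite scalerDl [h *: 1]mulr1 addrCA.
by split; [rewrite /derivable E|rewrite /derive E].
Qed.

(** * Distance to a closed set, and connected components containing segments and balls *)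

Lemma edist_attained (R : realType) (n : nat) (E : set 'rV[R]_n)
    (x : 'rV[R]_n) :
  closed E -> E !=set0 ->
  exists2 p, E p & edist_to x E = enorm (x - p) /\
    forall z, E z -> enorm (x - p) <= enorm (x - z).
Proof.
move=> Ecl [z0 Ez0]; set r := enorm (z0 - x).
(* Cutting [E] by the ball through one of its points [z0] gives a compact set and discards only
   points farther away than [z0]. *)
have Kc : compact (E `&` [set y | enorm (y - x) <= r]).
  by apply: (subclosed_compact _ (@eball_compact R n x r)) => [|y []//];
    apply: closedI => //; apply: compact_closed; [exact: norm_hausdorff|exact: (@eball_compact R n x r)].
have hc : continuous (fun y : 'rV[R]_n => - enorm (y - x)).
  by move=> y; exact: (cvgN (@enorm_sub_continuous R n x y)).
have [|p /[!inE]/= -[Ep pr] pmax] := EVT_max_rV _ Kc (continuous_subspaceT hc).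
  by exists z0; split => //; exact: lexx.
have pmin z : E z -> enorm (x - p) <= enorm (x - z).
  move=> Ez; rewrite ![enorm (x - _)]enormB.
  have [zr|/ltW rz] := leP (enorm (z - x)) r; last exact: le_trans rz.
  by rewrite -lerN2; apply: pmax; rewrite inE.
exists p => //; split => //; apply/eqP; rewrite eq_le; apply/andP; split.
  by apply: ge_inf; [exists 0 => _ [z _ <-]; exact: enorm_ge0|exists p].
by apply: lb_le_inf; [exists (enorm (x - p)); exists p|move=> _ [z Ez <-]; exact: pmin].
Qed.

Lemma edist_le (R : realType) (n : nat) (E : set 'rV[R]_n) (x z : 'rV[R]_n) :
  E z -> edist_to x E <= enorm (x - z).
Proof.
by move=> Ez; apply: ge_inf; [exists 0 => _ [y _ <-]; exact: enorm_ge0|exists z].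
Qed.

Lemma edist_lipschitz (R : realType) (n : nat) (E : set 'rV[R]_n)
    (x y : 'rV[R]_n) :
  closed E -> E !=set0 -> edist_to x E <= edist_to y E + enorm (x - y).
Proof.
move=> Ecl E0; have [p Ep [-> _]] := edist_attained y Ecl E0.
apply: le_trans (edist_le x Ep) _.
by have := ler_enorm_dist y x p; lra.
Qed.

Lemma edist_gt0 (R : realType) (n : nat) (E : set 'rV[R]_n) (x : 'rV[R]_n) :
  closed E -> E !=set0 -> (~` E) x -> 0 < edist_to x E.
Proof.
move=> Ecl E0 Ex; have [p Ep [-> _]] := edist_attained x Ecl E0.
rewrite lt_neqAle enorm_ge0 andbT; apply/eqP => /esym/enorm_eq0/eqP.
by rewrite subr_eq0 => /eqP xp; apply: Ex; rewrite xp.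
Qed.

Lemma edist_continuous (R : realType) (n : nat) (E : set 'rV[R]_n) :
  closed E -> E !=set0 -> continuous (fun x : 'rV[R]_n => edist_to x E).
Proof.
move=> Ecl E0 x; apply/(@cvgrPdist_lt R R _ (nbhs x) (nbhs_filter x)) => e e0.
have xx : enorm (x - x) < e by rewrite subrr enorm0.
near=> y; have ye : enorm (y - x) < e by near: y; exact: nbhs_eball.
apply: le_lt_trans ye; rewrite ler_norml.
have := edist_lipschitz x y Ecl E0; have := edist_lipschitz y x Ecl E0.
rewrite (enormB x y) => *; apply/andP; split; lra.
Unshelve. all: by end_near. Qed.

Lemma segment_connected_component (R : realType) (n : nat)
    (A : set 'rV[R]_n) (x y : 'rV[R]_n) :
  (forall t, 0 <= t <= 1 -> A (x + t *: (y - x))) -> connected_component A x y.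
Proof.
move=> Axy; pose g (t : R) : 'rV[R]_n := x + t *: (y - x).
have gc : continuous g.
  move=> t; apply: cvgD; first exact: cvg_cst.
  by apply: cvgZr_tmp; exact: cvg_id.
apply: (@connected_component_max _ A (g @` `[0, 1])).
- by exists 0; rewrite /= ?in_itv/= ?lexx ?ler01// /g scale0r addr0.
- by move=> _ [t /= /[!in_itv]/= t01 <-]; exact: Axy.
- apply: connected_continuous_connected; first exact: segment_connected.
  exact: continuous_subspaceT.
- by exists 1; rewrite /= ?in_itv/= ?lexx ?ler01// /g scale1r addrC subrK.
Qed.

Lemma eball_connected_component (R : realType) (n : nat)
    (A : set 'rV[R]_n) (x y : 'rV[R]_n) (r : R) :
  (forall z, enorm (z - x) < r -> A z) -> enorm (y - x) < r ->
  connected_component A x y.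
Proof.
move=> Ar yr; apply: segment_connected_component => t /andP[t0 t1]; apply: Ar.
rewrite [x + _]addrC addrK enormZ ger0_norm//; apply: le_lt_trans yr.
by rewrite ler_piMl// enorm_ge0.
Qed.

Lemma eball_edist (R : realType) (n : nat) (E : set 'rV[R]_n)
    (x z : 'rV[R]_n) :
  enorm (z - x) < edist_to x E -> (~` E) z.
Proof.
by rewrite enormB => zx Ez; have := edist_le x Ez; rewrite leNgt zx.
Qed.

(** * Comparison of [D] with the distance to [E], and convexity of [E] *)

Section eikonal.
Variables (R : realType) (n : nat) (E : set 'rV[R]_n) (D : 'rV[R]_n -> R).
Hypotheses (E_closed : closed E) (D_ge0 : forall x, 0 <= D x).
Hypotheses (D_cont : continuous D) (D_vanish : forall x, E x -> D x = 0).
Hypothesis D_diff : forall x, (~` E) x -> differentiable D x.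

(** This is [ascent] for [- D]: the gradient step climbs at any rate [k < c], and [D] cannot fall
    below 0. *)
Lemma eikonal_descent (x : 'rV[R]_n) (r c k : R) : 0 < c -> 0 <= k -> k < c ->
  0 <= r -> (forall y, enorm (y - x) < r -> (~` E) y /\ enorm (grad D y) = c) ->
  k * r <= D x.
Proof.
move=> c0 k0 kc r0 Dr.
have [y yr] : exists2 y, enorm (y - x) <= r & - D x + k * r <= - D y.
  apply: (@ascent _ _ (fun y => - D y)) => // [y|y yr _].
    exact: (cvgN (@D_cont y)).
  have [Ey gy] := Dr y yr; have dy := D_diff Ey.
  have gN : grad (- D) y = - grad D y.
    by apply/rowP => i; rewrite !mxE deriveN//; exact: diff_derivable.
  have [|||z zr fz] := @grad_ascent _ _ (- D) y k
      [set z | enorm (z - x) < r] (differentiableN dy).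
  - by rewrite gN enormN gy.
  - by rewrite gN enormN gy.
  - exact: nbhs_eball.
  - by exists z; [exact: ltW|exact: fz].
by have := D_ge0 y; lra.
Qed.

Lemma eikonal_le (x p : 'rV[R]_n) (c : R) : 0 <= c -> E p ->
  (forall y, enorm (y - x) < enorm (x - p) ->
     (~` E) y /\ enorm (grad D y) = c) ->
  D x <= c * enorm (x - p).
Proof.
move=> c0 Ep Dr; set v := x - p.
have [v0|v0] := eqVneq v 0.
  have -> : x = p by apply/eqP; rewrite -subr_eq0 -/v v0 eqxx.
  by rewrite D_vanish// mulr_ge0// enorm_ge0.
have evp : 0 < enorm v.
  by rewrite lt_neqAle enorm_ge0 andbT eq_sym; apply: contra_neq v0 => /enorm_eq0.
(* Only the endpoint [p], where [D] may fail to be differentiable, leaves the open ball; the mean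
   value theorem needs just continuity there. *)
have inball t : 0 < t -> t <= 1 -> enorm (p + t *: v - x) < enorm v.
  move=> t0 t1; have -> : p + t *: v - x = (t - 1) *: v.
    by rewrite scalerBl scale1r /v opprB addrAC addrC.
  rewrite enormZ ler0_norm ?subr_le0// gtr_pMl//; lra.
have [| |t] := @MVT R (fun t => D (p + t *: v)) (fun t => 'D_v D (p + t *: v)) 0 1
   ltr01.
- move=> t; rewrite in_itv/= => /andP[t0 t1]; apply: is_derive_line.
  by apply: D_diff; have [] := Dr _ (inball t t0 (ltW t1)).
- apply: continuous_subspaceT => t.
  apply: (@continuous_comp _ _ _ (fun t : R => p + t *: v) D); last exact: D_cont.
  by apply: cvgD; [exact: cvg_cst|apply: cvgZr_tmp; exact: cvg_id].
rewrite in_itv/= => /andP[t0 t1].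
rewrite scale1r scale0r addr0 (D_vanish Ep) !subr0 mulr1 addrC subrK => ->.
have [Et gt] := Dr _ (inball t t0 (ltW t1)).
by rewrite derive_grad; [rewrite -gt; exact: cauchy_schwarz|exact: D_diff].
Qed.

Hypothesis D_eik : forall x, (~` E) x -> exists2 c : R, 0 < c &
  forall y, connected_component (~` E) x y -> enorm (grad D y) = c.

(** If [E] were empty, the whole space would be one component, and descent over arbitrarily large
    balls would make [D 0] exceed every bound. *)
Lemma eikonal_nonempty : E !=set0.
Proof.
apply/set0P/negP => /eqP E0.
have {E0}Ex x : (~` E) x by rewrite E0.
have [c c0 Dc] := D_eik (Ex 0).
have D0 := D_ge0 0.
(* With slope [c / 2], this radius forces a drop of [D 0 + 1]. *)
have : c / 2 * ((D 0 + 1) / (c / 2)) <= D 0.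
  apply: (@eikonal_descent _ _ c) => //; [lra|lra|by apply: divr_ge0; lra|].
  by move=> y _; split=> //; apply: Dc; exact: segment_connected_component.
have -> : c / 2 * ((D 0 + 1) / (c / 2)) = D 0 + 1 by field; lra.
by rewrite leNgt ltrDl ltr01.
Qed.

Let E0 := eikonal_nonempty.

(** The open ball of radius [d] about [x] misses [E] and lies in one component, so both one-sided
    bounds apply on it with the same [c]. *)
Lemma eikonal_edist (x : 'rV[R]_n) (c : R) : (~` E) x -> 0 < c ->
  (forall y, connected_component (~` E) x y -> enorm (grad D y) = c) ->
  D x = c * edist_to x E.
Proof.
move=> Ex c0 Dc; set d := edist_to x E.
have d0 : 0 < d by exact: edist_gt0.
have ball y : enorm (y - x) < d -> (~` E) y /\ enorm (grad D y) = c.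
  move=> yd; split; first exact: eball_edist yd.
  by apply: Dc; apply: eball_connected_component yd => z; exact: eball_edist.
apply/eqP; rewrite eq_le; apply/andP; split.
  have [p Ep [dE _]] := edist_attained x E_closed E0.
  by rewrite /d dE; apply: eikonal_le => //; [exact: ltW|rewrite -dE].
have [//|Dd] := leP (c * d) (D x).
have k0 : 0 <= D x / d by rewrite divr_ge0// ltW.
(* The midpoint is a slope below [c] that exceeds [D x / d], contradicting descent. *)
pose k := (D x / d + c) / 2.
have Dxd : D x / d < c by rewrite ltr_pdivrMr.
have : k * d <= D x.
  by apply: (@eikonal_descent x d c k) => //; rewrite /k; lra.
rewrite -ler_pdivlMr// /k; lra.
Qed.

Lemma edist_ascent (x : 'rV[R]_n) (r k : R) : (~` E) x -> 0 <= r -> 0 <= k ->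
  k < 1 -> exists2 y, enorm (y - x) <= r & edist_to x E + k * r <= edist_to y E.
Proof.
move=> Ex r0 k0 k1; apply: (@ascent _ _ (fun y => edist_to y E)) => //.
  exact: edist_continuous.
move=> y yr xy.
(* The ball about [x] may meet [E] and several components. The bound [xy] keeps [y] off [E], and the
   constant [c] is that of the component of [y]. *)
have d0 : 0 < edist_to y E by exact: lt_le_trans (edist_gt0 E_closed E0 Ex) xy.
have Ey : (~` E) y by apply: (@eball_edist _ _ _ y); rewrite subrr enorm0.
have [c c0 Dc] := D_eik Ey.
have gy : enorm (grad D y) = c by apply: Dc; exact: connected_component_refl.
have [|||z [zr zd] Dz] := @grad_ascent _ _ D y (k * c)
  ([set z | enorm (z - x) < r] `&` [set z | enorm (z - y) < edist_to y E])
  (D_diff Ey).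
- by rewrite gy.
- by rewrite gy gtr_pMl.
- by apply: filterI; apply: nbhs_eball => //; rewrite subrr enorm0.
exists z; first exact: ltW.
(* Since [z] shares the component of [y], [D] is the same multiple [c] of the distance at both
   points, and [c] cancels from the gain. *)
have yz : connected_component (~` E) y z.
  by apply: eball_connected_component zd => w; exact: eball_edist.
have Ez := connected_component_sub yz.
have Dcz w : connected_component (~` E) z w -> enorm (grad D w) = c.
  by rewrite -(same_connected_component yz); exact: Dc.
move: Dz; rewrite (eikonal_edist Ey c0 Dc) (eikonal_edist Ez c0 Dcz).
by rewrite [k * c]mulrC -mulrA -mulrDr ltr_pM2l.
Qed.

(* Averaging [enorm (y - z) ^+ 2] over [z = a, b] with weights [t, 1 - t] gives
   [enorm (y - w) ^+ 2] plus a constant, whereas [edist_to y E] can be made to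
   grow like [edist_to w E + enorm (y - w)]. *)
Lemma eikonal_convex (a b : 'rV[R]_n) (t : R) : E a -> E b -> 0 <= t -> t <= 1 ->
  E (t *: a + (1 - t) *: b).
Proof.
move=> Ea Eb t0 t1; set w := t *: a + _; apply: contrapT => Ew.
set d := edist_to w E; have d0 : 0 < d by exact: edist_gt0.
pose C := t * enorm (w - a) ^+ 2 + (1 - t) * enorm (w - b) ^+ 2.
have C0 : 0 <= C by rewrite addr_ge0// mulr_ge0 ?sqr_ge0 ?subr_ge0.
have steiner y : t * enorm (y - a) ^+ 2 + (1 - t) * enorm (y - b) ^+ 2 =
    enorm (y - w) ^+ 2 + C.
  rewrite /C !enorm_sqr !mulr_sumr -!big_split/=; apply: eq_bigr => i _.
  by rewrite /w !mxE; ring.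
(* This makes [r * d = C + d ^+ 2]. The slope [1 - d / (2 * r)] loses only [d / 2] over length [r],
   so [y] is at least [r + d / 2] from [E], and [(r + d / 2) ^+ 2 > r ^+ 2 + C] contradicts
   [steiner]. *)
pose r := C / d + d.
have Cd : 0 <= C / d by rewrite divr_ge0// ltW.
have r0 : 0 < r by rewrite /r; lra.
have kr : (1 - d / (2 * r)) * r = r - d / 2 by field; rewrite gt_eqF.
have dr : d / (2 * r) <= 1 / 2.
  by rewrite ler_pdivrMr ?mulr_gt0// /r; lra.
have dr0 : 0 < d / (2 * r) by rewrite divr_gt0// mulr_gt0.
have [||y yr] := @edist_ascent w r (1 - d / (2 * r)) Ew (ltW r0); [lra|lra|].
rewrite kr -/d => dy.
have far z : E z -> (r + d / 2) ^+ 2 <= enorm (y - z) ^+ 2.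
  move=> Ez; rewrite ler_sqr ?nnegrE ?enorm_ge0//; last by lra.
  by apply: le_trans (edist_le y Ez); lra.
have h1 := ler_wpM2l t0 (far a Ea).
have t1' : 0 <= 1 - t by lra.
have h2 := ler_wpM2l t1' (far b Eb).
have := steiner y.
have : enorm (y - w) ^+ 2 <= r ^+ 2.
  by rewrite ler_sqr ?nnegrE ?enorm_ge0// ltW.
have rd : r * d = C + d ^+ 2 by rewrite /r; field; rewrite gt_eqF.
have : 0 < d ^+ 2 by rewrite exprn_gt0.
have : (r + d / 2) ^+ 2 = r ^+ 2 + r * d + d ^+ 2 / 4 by field.
lra.
Qed.

End eikonal.

Theorem theorem3p1 (R : realType) (n : nat) (E : set 'rV[R]_n)
    (D : 'rV[R]_n -> R)
    (E_closed : closed E)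
    (D_ge0 : forall x, 0 <= D x)
    (D_cont : continuous D)
    (D_vanish : forall x, E x -> D x = 0)
    (D_C1 : C1_on (~` E) D)
    (D_eik : forall x, (~` E) x ->
       exists2 c : R, 0 < c &
         forall y, connected_component (~` E) x y -> enorm (grad D y) = c) :
  convex_set E /\
  ((forall x, (~` E) x -> enorm (grad D x) = 1) ->
   forall x, D x = edist_to x E).
Proof.
have [D_diff _] := D_C1.
have E0 := eikonal_nonempty D_ge0 D_cont D_diff D_eik.
split=> [a b t /set_mem Ea /set_mem Eb|D1 x].
  apply/mem_set; apply: (eikonal_convex E_closed D_ge0 D_cont D_vanish D_diff D_eik) => //.
have [Ex|Ex] := pselect (E x).
  rewrite D_vanish//; apply/eqP; rewrite eq_le; apply/andP; split.
    have [p _ [-> _]] := edist_attained x E_closed E0; exact: enorm_ge0.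
  by have := edist_le x Ex; rewrite subrr enorm0.
(* Unit gradient is the case [c = 1] on every component. *)
rewrite -[RHS]mul1r; apply: (eikonal_edist E_closed D_ge0 D_cont D_vanish D_diff D_eik) => //.
by move=> y xy; apply: D1; exact: connected_component_sub xy.
Qed.
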